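(* Assume the global noise law (see context). Suppose that for every compact $K\subset\mathbb C\setminus[-b,b]$ and every $D>0$ there is a deterministic $a_n(K)\downarrow0$ such that $$\sup_{\|p\|=\|q\|=1}\mathbb P\Big(\sup_{\zeta\in K}\big|\langle p,\big((\zeta I-\mathcal X_n)^{-1}-\Pi(\zeta)\big)q\rangle\big|>a_n(K)\Big)\le n^{-D}$$ for all large $n$, where the supremum is over all pairs of deterministic unit vectors $p,q\in\mathbb F^{n+m}$. Assume that the signal frames $U_n,V_n$ are deterministic, or independent of $X_n$. If $r_n\le A\log n$ for a fixed $A<\infty$, then the holomorphic subspace local law holds on the signal space: for every compact $K\subset\mathbb C\setminus[-b,b]$ there is a deterministic $\varepsilon_n(K)\downarrow0$ such that, with probability tending to one, $\sup_{\zeta\in K}\|\mathcal G_n(\zeta)-\mathcal M(\zeta)\|_{\mathrm{op}}\le\varepsilon_n(K)$.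
   Context: Setting. $\mathbb F\in\{\mathbb R,\mathbb C\}$; for each $n$, $m=m(n)\ge n$ is an integer and $n/m\to c\in(0,1]$. $X_n$ is a random $n\times m$ matrix over $\mathbb F$. With $\mathrm{St}(N,r)=\{Q\in\mathbb F^{N\times r}:Q^*Q=I_r\}$, the signal frames are $U_n\in\mathrm{St}(n,r_n)$, $V_n\in\mathrm{St}(m,r_n)$. $a_n\downarrow0$ means a nonnegative sequence tending to $0$; $\langle p,q\rangle=p^*q$. Global noise law. There is a compactly supported probability measure $\mu$ on $[0,\infty)$ such that the empirical spectral measure of $X_nX_n^*$ converges weakly to $\mu$ in probability and $\|X_n\|_{\mathrm{op}}\to b:=\sqrt{\sup\operatorname{supp}\mu}$ in probability. For $\zeta\in\mathbb C\setminus[-b,b]$: $\phi(\zeta)=\int\frac{\zeta}{\zeta^2-x}\,\mu(dx)$, $\widetilde\phi(\zeta)=c\,\phi(\zeta)+\frac{1-c}{\zeta}$, $\Pi(\zeta)=\begin{pmatrix}\phi(\zeta)I_n&0\\0&\widetilde\phi(\zeta)I_m\end{pmatrix}$, $\mathcal M(\zeta)=\begin{pmatrix}\phi(\zeta)I_{r_n}&0\\0&\widetilde\phi(\zeta)I_{r_n}\end{pmatrix}$. $\mathcal X_n=\begin{pmatrix}0&X_n\\ X_n^*&0\end{pmatrix}$, $\mathcal E_n=\begin{pmatrix}U_n&0\\0&V_n\end{pmatrix}$, $\mathcal G_n(\zeta)=\mathcal E_n^*(\zeta I-\mathcal X_n)^{-1}\mathcal E_n$. Suprema over $K$ are $+\infty$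 if the resolvent is undefined somewhere on $K$. *)

(* Defs.v *)
From HB Require Import structures.
From mathcomp Require Import all_boot all_order all_algebra.
From mathcomp Require Import sesquilinear spectral complex.
From mathcomp Require Import all_classical all_reals all_analysis.

Set Implicit Arguments.
Unset Strict Implicit.
Unset Printing Implicit Defensive.

Import Order.TTheory GRing.Theory Num.Theory.
Import numFieldNormedType.Exports.

Local Open Scope classical_set_scope.
Local Open Scope ring_scope.
Local Open Scope complex_scope.
Local Open Scope sesquilinear_scope.

(* Matrices over the scalar field (the reals or the complex numbers) are
   complex matrices with entries in [scalars F]; over the reals, the conjugate
   transpose [^t*] is the transpose. *)
Inductive scalar_field := RealScalars | ComplexScalars.

Definition scalars (R : realType) (F : scalar_field) : {pred R[i]} :=
  if F is RealScalars then [pred z : R[i] | z \is Num.real] else predT.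

Section linear_algebra.
Context {R : realType}.
Local Notation C := R[i].

Definition l2norm k (v : 'cV[C]_k) : R :=
  Num.sqrt (\sum_(i < k) ComplexField.Normc.normc (v i 0) ^+ 2).

Definition unit_vectors (F : scalar_field) k : set 'cV[C]_k :=
  [set v | v \is a mxOver (scalars F) /\ l2norm v = 1].

Definition opnorm k l (A : 'M[C]_(k, l)) : R :=
  sup [set l2norm (A *m v) | v in [set v | l2norm v <= 1]].

Definition stiefel (F : scalar_field) N s : set 'M[C]_(N, s) :=
  [set Q | Q \is a mxOver (scalars F) /\ Q^t* *m Q = 1%:M].

Definition hermitization n m (X : 'M[C]_(n, m)) : 'M[C]_(n + m) :=
  block_mx 0 X (X^t*) 0.

Definition frame n m s (U : 'M[C]_(n, s)) (V : 'M[C]_(m, s)) :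
    'M[C]_(n + m, s + s) :=
  block_mx U 0 0 V.

(* Supremum over [z \in K] of a function [g] of [z] and of the resolvent of [H]
   at [z]; it is [+oo] if the resolvent is undefined somewhere on [K]. *)
Definition resolvent_sup k (H : 'M[C]_k) (K : set C^o) (g : C -> 'M[C]_k -> R) :
    \bar R :=
  ereal_sup [set if z%:M - H \in unitmx
                 then (g z (invmx (z%:M - H)))%:E else +oo%E | z in K].

End linear_algebra.

Section limit_law.
Context {R : realType} (mu : probability (measurableTypeR R) R).
Local Notation C := R[i].

Definition msupport : set R :=
  [set x | forall O : set R, open O -> O x -> (0 < mu O)%E].

Definition edge : R := Num.sqrt (sup msupport).

Definition spectral_cut : set C^o := [set x%:C | x in `[- edge, edge]].

Definition phi (z : C) : C :=
  (\int[mu]_x complex.Re (z / (z ^+ 2 - x%:C)))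
  +i* (\int[mu]_x complex.Im (z / (z ^+ 2 - x%:C))).

Definition phit (c : R) (z : C) : C := c%:C * phi z + (1 - c)%:C / z.

(* [Pi] is [phi_block n m]; [M] is [phi_block r r] *)
Definition phi_block (c : R) k l (z : C) : 'M[C]_(k + l) :=
  block_mx (phi z)%:M 0 0 (phit c z)%:M.

End limit_law.

(* For a normal [A], [spectral_diag A] lists the eigenvalues of [A] with
   multiplicity; they are real when [A] is Hermitian. *)
Definition eigvals (R : realType) n (A : 'M[R[i]]_n) : seq R :=
  [seq complex.Re (spectral_diag A 0 i) | i <- enum 'I_n].

Definition esm (R : realType) n (A : 'M[R[i]]_n) :
    {measure set (measurableTypeR R) -> \bar R} :=
  mscale (n%:R^-1 : R)%:nng
    (msum (fun k => \d_((eigvals A)`_k : measurableTypeR R)) n).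

Section random_matrices.
Context {R : realType}.
Local Notation C := R[i].

Definition mx_measurable d (T : measurableType d) k l
    (A : T -> 'M[C]_(k, l)) : Prop :=
  forall i j, measurable_fun [set: T] (fun w => complex.Re (A w i j)) /\
              measurable_fun [set: T] (fun w => complex.Im (A w i j)).

(* the events "Re A_ij (or Im A_ij) lies in a given Borel set" *)
Definition mx_events d (T : measurableType d) k l
    (A : T -> 'M[C]_(k, l)) : set (set T) :=
  [set E | exists i j, exists2 B : set R, measurable B &
     E = [set w | B (complex.Re (A w i j))] \/
     E = [set w | B (complex.Im (A w i j))]].

(* independence of the sigma-algebras generated by [E1] and by [E2] *)
Definition indep_generated d (T : measurableType d) (P : probability T R)
    (E1 E2 : set (set T)) : Prop :=
  forall B1 B2 : set T, <<s E1 >> B1 -> <<s E2 >> B2 ->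
    P (B1 `&` B2) = (P B1 * P B2)%E.

Definition deterministic (S V : Type) (Y : S -> V) : Prop :=
  exists y, forall w, Y w = y.

Definition cvg_in_prob (d : nat -> measure_display)
    (T : forall n, measurableType (d n)) (P : forall n, probability (T n) R)
    (Y : forall n, T n -> R) (l : R) : Prop :=
  forall e : R, 0 < e ->
    (fun n => P n [set w | e < `|Y n w - l|]) @ \oo --> 0%E.

(* nonnegative and tending to 0, not necessarily monotone *)
Definition null_seq (a : nat -> R) : Prop :=
  (forall n, 0 <= a n) /\ a @ \oo --> (0 : R).

Definition global_noise_law (d : nat -> measure_display)
    (T : forall n, measurableType (d n)) (P : forall n, probability (T n) R)
    (m : nat -> nat) (X : forall n, T n -> 'M[C]_(n, m n))
    (mu : probability (measurableTypeR R) R) : Prop :=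
  [/\ compact (msupport mu), mu [set x | 0 <= x] = 1%E,
      forall f : R -> R, continuous f -> (exists B : R, forall x, `|f x| <= B) ->
        cvg_in_prob P
          (fun n w => \int[esm (X n w *m (X n w)^t*)]_x f x) (\int[mu]_x f x)
    & cvg_in_prob P (fun n w => opnorm (X n w)) (edge mu)].

(* |<p, (G - Pi(z)) q>| *)
Definition bilinear_error (mu : probability (measurableTypeR R) R) (c : R) n m
    (p q : 'cV[C]_(n + m)) (z : C) (G : 'M[C]_(n + m)) : R :=
  ComplexField.Normc.normc ((p^t* *m (G - phi_block mu c n m z) *m q) 0 0).

Definition isotropic_local_law (F : scalar_field) (d : nat -> measure_display)
    (T : forall n, measurableType (d n)) (P : forall n, probability (T n) R)
    (m : nat -> nat) (X : forall n, T n -> 'M[C]_(n, m n))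
    (mu : probability (measurableTypeR R) R) (c : R) : Prop :=
  forall (K : set C^o) (D : R),
    compact K -> K `<=` ~` spectral_cut mu -> 0 < D ->
  exists2 a : nat -> R, null_seq a &
  \forall n \near \oo,
    (ereal_sup
       [set P n [set w | (a n)%:E <
          resolvent_sup (hermitization (X n w)) K (bilinear_error mu c p q)]
       | p in @unit_vectors R F (n + m n)%N & q in @unit_vectors R F (n + m n)%N]
     <= (n%:R `^ (- D)%R)%:E)%E.

Definition holomorphic_subspace_local_law (d : nat -> measure_display)
    (T : forall n, measurableType (d n)) (P : forall n, probability (T n) R)
    (m r : nat -> nat) (X : forall n, T n -> 'M[C]_(n, m n))
    (U : forall n, T n -> 'M[C]_(n, r n))
    (V : forall n, T n -> 'M[C]_(m n, r n))
    (mu : probability (measurableTypeR R) R) (c : R) : Prop :=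
  forall K : set C^o, compact K -> K `<=` ~` spectral_cut mu ->
  exists2 eps : nat -> R, null_seq eps &
  (fun n => P n [set w |
     (resolvent_sup (hermitization (X n w)) K
        (fun z G => opnorm ((frame (U n w) (V n w))^t* *m G
           *m frame (U n w) (V n w) - phi_block mu c (r n) (r n) z))
      <= (eps n)%:E)%E]) @ \oo --> 1%E.

End random_matrices.

(* Main.v *)
Require Import Defs.
From HB Require Import structures.
From mathcomp Require Import all_boot all_order all_algebra.
From mathcomp Require Import sesquilinear spectral complex.
From mathcomp Require Import all_classical all_reals all_analysis.
From mathcomp Require Import ring lra.

Set Implicit Arguments.
Unset Strict Implicit.
Unset Printing Implicit Defensive.

Import Order.TTheory GRing.Theory Num.Theory.
Import numFieldNormedType.Exports.

Local Open Scope classical_set_scope.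
Local Open Scope ring_scope.

(** The resolvent is only controlled one pair of vectors at a time, but on an
    event of probability [1 - n^-D] with [D] at our disposal.  Since the frame
    [E = diag(U, V)] has [2r] columns, the operator norm of the compressed error
    [E^* (G - Pi) E] is decided, up to a factor, by a finite net of pairs of
    test vectors whose cardinality is exponential in [r] ([card_net],
    [opnorm_net]).  For [r <= A log n] this is a power of [n], so a union bound
    with [D] large enough loses nothing ([net_cardinality_beaten]).  The
    subtracted term is right because [E] is an isometry which intertwines the
    two block matrices: [E^* Pi E = M] ([frame_phi_block]).

    The net is real for both scalar fields: for every [z] the error is a complex
    matrix, and a complex bilinear form is bounded by its values on the real and
    imaginary parts of its arguments.  Thus the test vectors [E p] always belong
    to the class of vectors for which the isotropic law is assumed.

    When the frame is random, [E p] is not deterministic.  By independence the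
    joint law of noise and frame is a product measure, and Fubini lets the
    isotropic law be applied with the frame frozen ([indep_generated_bound],
    [frame_bilinear_bound]).

    All this concerns events which are uncountable intersections over the
    spectral parameter [z] in [K], and in which [phi] enters as an arbitrary
    function of [z].  They are measurable because the inequalities, multiplied
    by [det (z - H)] and squared, are polynomial in the real and imaginary parts
    of [H], [z] and [Pi z], hence may be tested on countably many [z] for which
    the points [(z, Pi z)] are dense in the graph of [Pi] over [K];
    invertibility on all of [K] is not such a condition, but on the compact [K]
    it amounts to a uniform lower bound for [|det (z - H)|]
    ([resolvent_set_gap], [measurable_resolvent_event]). *)

Local Open Scope complex_scope.
Local Open Scope sesquilinear_scope.
Import ComplexField.Normc.

(** * Algebras of functions and matrices of such functions *)

Lemma normc_ge0 (R : realType) (z : R[i]) : 0 <= normc z.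
Proof. by case: z => a b; exact: sqrtr_ge0. Qed.

Section function_algebra.
Context {R : realType} {T : Type}.
Local Notation C := R[i].

(** Measurability in the sample point and continuity in the test point are both
    needed for the same expressions in a resolvent.  Each of them defines such
    an algebra, and polynomial expressions in matrices are treated once. *)
Definition function_algebra (S : (T -> R) -> Prop) : Prop :=
  [/\ forall a, S (fun=> a), forall f g, S f -> S g -> S (fun t => f t + g t)
    & forall f g, S f -> S g -> S (fun t => f t * g t)].

Variable S : (T -> R) -> Prop.
Hypothesis S_alg : function_algebra S.

Let SC a : S (fun=> a). Proof. by have [] := S_alg. Qed.
Let SD f g : S f -> S g -> S (fun t => f t + g t).
Proof. by have [_ + _] := S_alg; exact. Qed.
Let SM f g : S f -> S g -> S (fun t => f t * g t).
Proof. by have [_ _] := S_alg; exact. Qed.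

Lemma algN f : S f -> S (fun t => - f t).
Proof.
by move=> Sf; under eq_fun do rewrite -mulN1r; exact: SM.
Qed.

Lemma algB f g : S f -> S g -> S (fun t => f t - g t).
Proof. by move=> Sf Sg; apply: SD => //; exact: algN. Qed.

Lemma alg_sum (I : Type) (s : seq I) (f : T -> I -> R) :
  (forall i, S (f^~ i)) -> S (fun t => \sum_(i <- s) f t i).
Proof.
move=> Sf; elim: s => [|i s IH].
  by under eq_fun do rewrite big_nil; exact: SC.
by under eq_fun do rewrite big_cons; exact: SD.
Qed.

Definition calg (f : T -> C) : Prop :=
  S (fun t => complex.Re (f t)) /\ S (fun t => complex.Im (f t)).

Lemma calg_cst a : calg (fun=> a). Proof. by split; exact: SC. Qed.

Lemma calgD f g : calg f -> calg g -> calg (fun t => f t + g t).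
Proof.
by move=> [f1 f2] [g1 g2]; split; under eq_fun do rewrite raddfD; exact: SD.
Qed.

Lemma calgM f g : calg f -> calg g -> calg (fun t => f t * g t).
Proof.
have ReM (a b : C) : complex.Re (a * b) =
    complex.Re a * complex.Re b - complex.Im a * complex.Im b.
  by case: a b => [? ?] [].
have ImM (a b : C) : complex.Im (a * b) =
    complex.Re a * complex.Im b + complex.Im a * complex.Re b.
  by case: a b => [? ?] [].
move=> [f1 f2] [g1 g2]; split.
  by under eq_fun do rewrite ReM; apply: algB; exact: SM.
by under eq_fun do rewrite ImM; apply: SD; exact: SM.
Qed.

Lemma calgB f g : calg f -> calg g -> calg (fun t => f t - g t).
Proof.
move=> Sf Sg; under eq_fun do rewrite -mulN1r.
by apply: calgD => //; apply: calgM => //; exact: calg_cst.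
Qed.

Lemma calg_conj f : calg f -> calg (fun t => (f t)^*).
Proof.
move=> [f1 f2]; split.
  rewrite (_ : (fun _ => _) = (fun t => complex.Re (f t)))//.
  by apply/funext => t; case: (f t).
rewrite (_ : (fun _ => _) = (fun t => - complex.Im (f t))); first exact: algN.
by apply/funext => t; case: (f t).
Qed.

Lemma calg_sum (I : Type) (s : seq I) (f : T -> I -> C) :
  (forall i, calg (f^~ i)) -> calg (fun t => \sum_(i <- s) f t i).
Proof.
move=> Sf; elim: s => [|i s IH].
  by under eq_fun do rewrite big_nil; exact: calg_cst.
by under eq_fun do rewrite big_cons; exact: calgD.
Qed.

Lemma calg_prod (I : Type) (s : seq I) (f : T -> I -> C) :
  (forall i, calg (f^~ i)) -> calg (fun t => \prod_(i <- s) f t i).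
Proof.
move=> Sf; elim: s => [|i s IH].
  by under eq_fun do rewrite big_nil; exact: calg_cst.
by under eq_fun do rewrite big_cons; exact: calgM.
Qed.

Definition mxalg k l (A : T -> 'M[C]_(k, l)) : Prop :=
  forall i j, calg (fun t => A t i j).

Lemma mxalg_cst k l (A : 'M[C]_(k, l)) : mxalg (fun=> A).
Proof. by move=> i j; exact: calg_cst. Qed.

Lemma mxalgB k l (A B : T -> 'M[C]_(k, l)) :
  mxalg A -> mxalg B -> mxalg (fun t => A t - B t).
Proof.
by move=> SA SB i j; under eq_fun do rewrite mxE [X in _ + X]mxE; exact: calgB.
Qed.

Lemma mxalgM k l p (A : T -> 'M[C]_(k, l)) (B : T -> 'M[C]_(l, p)) :
  mxalg A -> mxalg B -> mxalg (fun t => A t *m B t).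
Proof.
move=> SA SB i j; under eq_fun do rewrite mxE.
by apply: calg_sum => h; exact: calgM.
Qed.

Lemma mxalgZ k l f (A : T -> 'M[C]_(k, l)) :
  calg f -> mxalg A -> mxalg (fun t => f t *: A t).
Proof. by move=> Sf SA i j; under eq_fun do rewrite mxE; exact: calgM. Qed.

Lemma mxalg_scalar k f : calg f -> mxalg (fun t => (f t)%:M : 'M[C]_k).
Proof.
move=> Sf i j; under eq_fun do rewrite mxE.
by case: (i == j) => //; exact: calg_cst.
Qed.

Lemma mxalg_adjoint k l (A : T -> 'M[C]_(k, l)) :
  mxalg A -> mxalg (fun t => (A t)^t*).
Proof. by move=> SA i j; under eq_fun do rewrite !mxE; exact: calg_conj. Qed.

Lemma mxalg_block k1 k2 l1 l2
    (A : T -> 'M[C]_(k1, l1)) (B : T -> 'M[C]_(k1, l2))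
    (A' : T -> 'M[C]_(k2, l1)) (B' : T -> 'M[C]_(k2, l2)) :
  mxalg A -> mxalg B -> mxalg A' -> mxalg B' ->
  mxalg (fun t => block_mx (A t) (B t) (A' t) (B' t)).
Proof.
move=> SA SB SA' SB' i j; under eq_fun do rewrite mxE.
case: (fintype.split i) => i'; under eq_fun do rewrite mxE;
by case: (fintype.split j) => j'.
Qed.

Lemma calg_det k (A : T -> 'M[C]_k) : mxalg A -> calg (fun t => \det (A t)).
Proof.
move=> SA; apply: calg_sum => s; apply: calgM; first exact: calg_cst.
exact: calg_prod.
Qed.

(** Products with the adjugate replace inverse matrices below: the adjugate is
    polynomial in the entries and defined whether or not the matrix is
    invertible. *)
Lemma mxalg_adj k (A : T -> 'M[C]_k) : mxalg A -> mxalg (fun t => \adj (A t)).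
Proof.
move=> SA i j; under eq_fun do rewrite mxE /cofactor.
apply: calgM; first exact: calg_cst.
apply: calg_det => i' j'; under eq_fun do rewrite !mxE; exact: SA.
Qed.

Lemma alg_normc2 f :
  calg f -> S (fun t => normc (f t) ^+ 2).
Proof.
move=> [f1 f2].
rewrite (_ : (fun _ => _) = (fun t => complex.Re (f t) * complex.Re (f t) +
   complex.Im (f t) * complex.Im (f t))); first by apply: SD; exact: SM.
apply/funext => t; case: (f t) => a b /=.
by rewrite sqr_sqrtr ?addr_ge0 ?sqr_ge0// !expr2.
Qed.

Lemma alg_l2norm2 k (v : T -> 'cV[C]_k) :
  mxalg v -> S (fun t => l2norm (v t) ^+ 2).
Proof.
move=> Sv; under eq_fun => t.
  by rewrite sqr_sqrtr; [over|apply: sumr_ge0 => i _; exact: sqr_ge0].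
by apply: alg_sum => i; exact: alg_normc2.
Qed.

End function_algebra.

Lemma measurable_function_algebra (R : realType) d (T : measurableType d) :
  function_algebra (fun f : T -> R => measurable_fun [set: T] f).
Proof.
split=> [a|f g|f g]; first exact: measurable_cst.
  exact: measurable_realfun.measurable_funD.
exact: measurable_realfun.measurable_funM.
Qed.

Lemma seq_continuous_function_algebra (R : realType) I (s : nat -> I) (i : I) :
  function_algebra (fun f : I -> R => f (s n) @[n --> \oo] --> f i).
Proof.
by split=> [a|f g|f g]; [exact: cvg_cst|exact: cvgD|exact: cvgM].
Qed.

(** * Uncountable families of inequalities *)

Lemma cvg_harmonic_bound (R : realType) (u : nat -> R) (l : R) :
  (forall n, `|l - u n| <= n.+1%:R^-1) -> u n @[n --> \oo] --> l.
Proof.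
move=> ul; apply/cvgrPdist_le => e e0; near=> n.
apply: le_trans (ul n) _.
by near: n; have := near_infty_natSinv_lt (PosNum e0); apply: filterS => n /ltW.
Unshelve. all: by end_near. Qed.

(** Every subset of a separable metric space is separable.  Nothing is asked of
    [f]: density is measured through the values [f i] only, which is what makes
    a discontinuous [f] harmless. *)
Lemma countable_dense_family (R : realType) (I : Type) (J : finType)
    (f : I -> J -> R) (A : set I) :
  exists e : nat -> option I,
    (forall c i, e c = Some i -> A i) /\
    forall i, A i -> exists2 s : nat -> I,
      forall n, exists c, e c = Some (s n) &
      forall j, f (s n) j @[n --> \oo] --> f i j.
Proof.
(* One index is kept in each nonempty cell of each grid of mesh [1 / (N + 1)]. *)
pose cell (x : nat * {ffun J -> int}) (i : I) :=
  A i /\ forall j, Num.floor (x.1.+1%:R * f i j) = x.2 j.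
have choice_of x : exists o : option I,
    if o is Some i then cell x i else forall i, ~ cell x i.
  have [[i xi]|xN] := pselect (exists i, cell x i); first by exists (Some i).
  by exists None => i xi; apply: xN; exists i.
have [g gP] := choice choice_of.
exists (fun c => if unpickle c is Some x then g x else None); split.
  move=> c i; case: (unpickle c) => // x gx.
  by have := gP x; rewrite gx => -[].
move=> i Ai.
pose x n := (n, [ffun j => Num.floor (n.+1%:R * f i j)] : {ffun J -> int}).
have xi n : cell (x n) i by split => // j; rewrite ffunE.
have gx n : exists y, g (x n) = Some y.
  by have := gP (x n); case: (g (x n)) => [y|/(_ i)//]; exists y.
have [s sP] := choice gx; exists s.
  by move=> n; exists (pickle (x n)); rewrite pickleK.
move=> j; apply: cvg_harmonic_bound => n.
have := gP (x n); rewrite sP => -[_ /(_ j)] /=; rewrite ffunE => fE.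
have n0 : 0 < n.+1%:R :> R by rewrite ltr0n.
rewrite -(ler_pM2l n0) mulfV ?gt_eqF// -{1}(gtr0_norm n0) -normrM mulrBr.
have := floor_itv (n.+1%:R * f i j); have := floor_itv (n.+1%:R * f (s n) j).
rewrite fE intrD => /andP[a1 b1] /andP[a2 b2].
by rewrite ler_norml; apply/andP; split; lra.
Qed.

(** The inequalities are only required to be closed along sequences in which
    the coordinates [f] converge, so a countable subfamily implies all of
    them. *)
Lemma measurable_forall_le0 (R : realType) d (T : measurableType d) (I : Type)
    (J : finType) (f : I -> J -> R) (A : set I) (g : T -> I -> R) :
  (forall i, measurable_fun [set: T] (g^~ i)) ->
  (forall w i (s : nat -> I), (forall j, f (s n) j @[n --> \oo] --> f i j) ->
     g w (s n) @[n --> \oo] --> g w i) ->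
  measurable [set w | forall i, A i -> g w i <= 0].
Proof.
move=> mg cg; have [e [eA edense]] := countable_dense_family f A.
rewrite (_ : [set _ | _] =
  \bigcap_c [set w | if e c is Some i then g w i <= 0 else True]).
  apply: bigcapT_measurable => c; case: (e c) => [i|].
    rewrite -[X in measurable X]setTI.
    by apply: measurable_fun_le => //; exact: measurable_cst.
  by rewrite (_ : [set _ | _] = setT)//; apply/seteqP.
apply/seteqP; split => w /= gw.
  by move=> c _ /=; case ec : (e c) => [i|//]; apply: gw; exact: eA ec.
move=> i /edense[s es fs].
apply: (closed_cvg _ (@closed_le R 0) _ _ (cg w i s fs)).
by near=> n; have [c ec] := es n; have := gw c Logic.I; rewrite /= ec.
Unshelve. all: by end_near. Qed.

(** * Invertibility over a compact set of spectral parameters *)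

Lemma continuous_horner_numField (K : numFieldType) (p : {poly K}) :
  continuous (horner p).
Proof.
elim/poly_ind: p => [|p a IH] z.
  rewrite (_ : horner _ = cst 0); first exact: cst_continuous.
  by apply/funext => x; rewrite horner0.
rewrite (_ : horner _ = (fun x => p.[x] * x + a)).
  exact: (cvgD (cvgM (IH z) cvg_id) (cvg_cst a)).
by apply/funext => x; rewrite hornerMXaddC.
Qed.

(** The characteristic polynomial is continuous, so the image of [K] under it is
    compact; if it misses [0] it misses a ball around [0].  The integer [j] makes
    the lower bound range over a countable set. *)
Lemma resolvent_set_gap (R : realType) k (H : 'M[R[i]]_k) (K : set R[i]^o) :
  compact K -> (forall z, K z -> z%:M - H \in unitmx) ->
  exists j : nat, forall z, K z ->
    j.+1%:R^-1 <= normc (\det (z%:M - H)) ^+ 2.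
Proof.
move=> cK uK.
have detE (z : R[i]) : \det (z%:M - H) = (char_poly H).[z].
  rewrite /char_poly -horner_evalE -det_map_mx; congr (\det _).
  apply/matrixP => i j; rewrite !mxE /= /horner_eval hornerD hornerN hornerC.
  by rewrite hornerMn hornerX.
have clo : closed (horner (char_poly H) @` K : set R[i]^o).
  apply: compact_closed; first exact: norm_hausdorff.
  apply: continuous_compact => //; apply: continuous_subspaceT.
  exact: continuous_horner_numField.
have : nbhs (0 : R[i]^o) (~` (horner (char_poly H) @` K)).
  apply: open_nbhs_nbhs; split; first exact: closed_openC.
  by move=> [z /uK]; rewrite unitmxE detE unitfE => /eqP.
move=> /nbhs_ballP[[e e'] /=]; rewrite ltcE /= => /andP[/eqP-> e0] eK.
have e20 : 0 < e ^+ 2 by rewrite exprn_gt0.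
have [j _ /(_ j (leqnn _)) ej] := near_infty_natSinv_lt (PosNum e20).
exists j => z Kz; apply: le_trans (ltW ej) _ => /=.
rewrite ler_pXn2r ?nnegrE ?normc_ge0 ?(ltW e0)//.
rewrite leNgt; apply/negP => ze.
apply: (eK (char_poly H).[z]); last by exists z.
by rewrite -ball_normE /= sub0r normrN -detE ltcR.
Qed.

(** * Measurability of uniform resolvent bounds *)

Section l2norm_theory.
Context {R : realType}.
Local Notation C := R[i].

Lemma l2norm_ge0 k (v : 'cV[C]_k) : 0 <= l2norm v.
Proof. exact: sqrtr_ge0. Qed.

Lemma sqr_l2norm k (v : 'cV[C]_k) :
  l2norm v ^+ 2 = \sum_(i < k) normc (v i 0) ^+ 2.
Proof. by rewrite sqr_sqrtr// sumr_ge0// => i _; exact: sqr_ge0. Qed.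

Lemma l2normZ k a (v : 'cV[C]_k) : l2norm (a *: v) = normc a * l2norm v.
Proof.
apply/eqP; rewrite -(@eqrXn2 _ 2)// ?mulr_ge0 ?l2norm_ge0 ?normc_ge0//.
rewrite exprMn !sqr_l2norm mulr_sumr; apply/eqP/eq_bigr => i _.
by rewrite mxE normcM exprMn.
Qed.

End l2norm_theory.

Lemma resolvent_sup_le (R : realType) k (H : 'M[R[i]]_k) (K : set R[i]^o)
    (g : R[i] -> 'M[R[i]]_k -> R) (e : R) :
  (resolvent_sup H K g <= e%:E)%E <->
  forall z, K z -> z%:M - H \in unitmx /\ g z (invmx (z%:M - H)) <= e.
Proof.
split=> [h z Kz|h].
  have := le_trans (ereal_sup_ubound (ex_intro2 _ _ z Kz erefl)) h.
  by case: ifP.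
apply: ge_ereal_sup => _ [z /h[uz gz] <-].
by rewrite uz lee_fin.
Qed.

(** The bilinear error and the compressed operator norm are both of the form
    [l2norm (L (G - Pi z) Q v)] with [v] in a set [B]: a single vector for the
    former, the unit ball for the latter. *)
Section measurable_resolvent_event.
Context {R : realType} d (T : measurableType d) (N a b : nat).
Local Notation C := R[i].
Variables (Pi : C -> 'M[C]_N) (K : set C^o) (B : set 'cV[C]_b).
Variables (H : T -> 'M[C]_N) (L : T -> 'M[C]_(a, N)) (Q : T -> 'M[C]_(N, b)).
Hypothesis cK : compact K.
Hypotheses (mH : mx_measurable H) (mL : mx_measurable L) (mQ : mx_measurable Q).

Let J : finType := (bool * (unit + 'I_N * 'I_N + 'I_b))%type.

Let coordinate (x : C * 'cV[C]_b) (j : J) : R :=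
  let c := match j.2 with
    | inl (inl _) => x.1
    | inl (inr p) => Pi x.1 p.1 p.2
    | inr i => x.2 i 0
    end in
  if j.1 then complex.Re c else complex.Im c.

(* [det (z - H)] times the vector whose norm is to be bounded. *)
Let numerator w (x : C * 'cV[C]_b) : 'cV[C]_a :=
  L w *m (\adj (x.1%:M - H w) - \det (x.1%:M - H w) *: Pi x.1) *m Q w *m x.2.

Let gap w (x : C * 'cV[C]_b) : R := normc (\det (x.1%:M - H w)) ^+ 2.

Let slack e w (x : C * 'cV[C]_b) : R :=
  l2norm (numerator w x) ^+ 2 - e ^+ 2 * gap w x.

Let mxalg_numerator X S (S_alg : function_algebra S)
    (w : X -> T) (x : X -> C * 'cV[C]_b) :
  calg S (fun t => (x t).1) -> mxalg S (fun t => Pi (x t).1) ->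
  mxalg S (fun t => (x t).2) -> mxalg S (fun t => H (w t)) ->
  mxalg S (fun t => L (w t)) -> mxalg S (fun t => Q (w t)) ->
  S (fun t => gap (w t) (x t)) /\ forall e, S (fun t => slack e (w t) (x t)).
Proof.
move=> Sz SPi Sv SH SL SQ.
have SzH : mxalg S (fun t => (x t).1%:M - H (w t)).
  by apply: mxalgB => //; exact: mxalg_scalar.
have Sdet := calg_det S_alg SzH.
have Sgap := alg_normc2 S_alg Sdet.
split=> // e; apply: (algB S_alg); last first.
  by case: S_alg => SC _; apply => //; exact: SC.
apply: alg_l2norm2 => //; do 2 apply: mxalgM => //; apply: mxalgM => //.
by apply: mxalgB => //; [exact: mxalg_adj|exact: mxalgZ].
Qed.

Let measurable_gap_slack x :
  measurable_fun [set: T] (gap^~ x) /\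
  forall e, measurable_fun [set: T] ((slack e)^~ x).
Proof.
have S_alg := @measurable_function_algebra R d T.
refine (@mxalg_numerator T _ S_alg id (fun=> x) _ _ _ mH mL mQ).
- exact: calg_cst.
- exact: mxalg_cst.
- exact: mxalg_cst.
Qed.

Let seq_continuous_gap_slack w x (s : nat -> C * 'cV[C]_b) :
  (forall j, coordinate (s n) j @[n --> \oo] --> coordinate x j) ->
  (gap w (s n) @[n --> \oo] --> gap w x) /\
  forall e, slack e w (s n) @[n --> \oo] --> slack e w x.
Proof.
move=> sx; have S_alg := @seq_continuous_function_algebra R _ s x.
refine (@mxalg_numerator _ _ S_alg (fun=> w) id _ _ _ _ _ _); last 3 first.
- exact: mxalg_cst.
- exact: mxalg_cst.
- exact: mxalg_cst.
- by split; [exact: sx (true, inl (inl tt))|exact: sx (false, inl (inl tt))].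
- move=> i j.
  split; first exact: sx (true, inl (inr (i, j))).
  exact: sx (false, inl (inr (i, j))).
- move=> i j; rewrite ord1.
  by split; [exact: sx (true, inr i)|exact: sx (false, inr i)].
Qed.

Let slack_le0 e w x : 0 <= e -> x.1%:M - H w \in unitmx ->
  (slack e w x <= 0) =
  (l2norm (L w *m (invmx (x.1%:M - H w) - Pi x.1) *m Q w *m x.2) <= e).
Proof.
move=> e0 u; rewrite /slack /gap.
have -> : numerator w x = \det (x.1%:M - H w) *:
    (L w *m (invmx (x.1%:M - H w) - Pi x.1) *m Q w *m x.2).
  by rewrite /invmx u 2!scalemxAl scalemxAr scalerBr scalerA mulrV ?scale1r//.
have d0 : 0 < normc (\det (x.1%:M - H w)) ^+ 2.
  rewrite exprn_gt0// lt_def normc_ge0 andbT; apply/eqP => /eq0_normc d0.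
  by move: u; rewrite unitmxE d0 unitr0.
rewrite l2normZ exprMn mulrC subr_le0 ler_pM2r//.
by rewrite ler_pXn2r// nnegrE l2norm_ge0.
Qed.

Lemma measurable_resolvent_event e : 0 <= e ->
  measurable [set w | forall z, K z -> z%:M - H w \in unitmx /\
    forall v, B v ->
      l2norm (L w *m (invmx (z%:M - H w) - Pi z) *m Q w *m v) <= e].
Proof.
move=> e0.
(* [S1] ignores the vector component, so that invertibility is demanded even
   if [B] is empty. *)
pose S1 : set (C * 'cV[C]_b) := [set x | K x.1].
pose S2 : set (C * 'cV[C]_b) := [set x | K x.1 /\ B x.2].
have gap0 w z : K z -> 
    (exists j : nat, forall x, S1 x -> j.+1%:R^-1 - gap w x <= 0) ->
    z%:M - H w \in unitmx.
  move=> Kz [j /(_ (z, 0) Kz)]; rewrite subr_le0 => jz.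
  rewrite unitmxE unitfE; apply/eqP => dz; move: jz.
  by rewrite /gap dz normc0 expr0n/= leNgt invr_gt0 ltr0n.
rewrite (_ : [set w | _] =
  (\bigcup_j [set w | forall x, S1 x -> j.+1%:R^-1 - gap w x <= 0]) `&`
  [set w | forall x, S2 x -> slack e w x <= 0]).
  apply: measurableI.
    apply: bigcupT_measurable => j.
    apply: (measurable_forall_le0 (f := coordinate)) => [x|w x s sx].
      apply: measurable_realfun.measurable_funB; first exact: measurable_cst.
      by case: (measurable_gap_slack x).
    by apply: cvgB; [exact: cvg_cst|case: (seq_continuous_gap_slack w sx)].
  apply: (measurable_forall_le0 (f := coordinate)) => [x|w x s sx].
    by case: (measurable_gap_slack x).
  by case: (seq_continuous_gap_slack w sx).
apply/seteqP; split => w /=.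
  move=> h; split.
    have [j jP] := resolvent_set_gap cK (fun z Kz => (h z Kz).1).
    by exists j => // x Kx; rewrite subr_le0; exact: jP.
  by move=> [z v] [/= /h[u hv] Bv]; rewrite slack_le0//; exact: hv.
move=> [[j _ jP] h] z Kz; have u : z%:M - H w \in unitmx.
  by apply: gap0 => //; exists j.
by split=> // v Bv; rewrite -(slack_le0 (x := (z, v)))//; exact: h.
Qed.

End measurable_resolvent_event.

(** * Freezing an independent variable *)

(** Independence says that under [w |-> (w, w)] the law [P] becomes the product
    of its restrictions to the two sigma-algebras.  The probability of [E] on the
    diagonal is therefore an average of probabilities of sections of [E], each
    of which involves a single copy of [w]. *)
Section indep_generated_bound.
Context {R : realType} d (T : measurableType d) (P : probability T R).
Variables G1 G2 : set (set T).
Hypothesis mG1 : G1 `<=` measurable.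
Hypothesis mG2 : G2 `<=` measurable.
Hypothesis indepG : indep_generated P G1 G2.

Local Notation T1 := (g_sigma_algebraType G1).
Local Notation T2 := (g_sigma_algebraType G2).

Let coarsen1 : T -> T1 := id.
Let coarsen2 : T -> T2 := id.
Let diagonal : T -> T1 * T2 := fun w => (w, w).

Let measurable_coarsen (G : set (set T)) : G `<=` measurable ->
  measurable_fun [set: T] (id : T -> g_sigma_algebraType G).
Proof.
move=> mG _ A sA; rewrite setTI preimage_id.
exact: (smallest_sub (sigma_algebra_measurable T) mG sA).
Qed.

Let measurable_coarsen1 : measurable_fun [set: T] coarsen1.
Proof. exact: measurable_coarsen. Qed.

Let measurable_coarsen2 : measurable_fun [set: T] coarsen2.
Proof. exact: measurable_coarsen. Qed.

Let measurable_diagonal : measurable_fun [set: T] diagonal.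
Proof.
exact: (measurable_fun_pair measurable_coarsen1 measurable_coarsen2).
Qed.

HB.instance Definition _ :=
  isMeasurableFun.Build _ _ _ _ coarsen1 measurable_coarsen1.
HB.instance Definition _ :=
  isMeasurableFun.Build _ _ _ _ coarsen2 measurable_coarsen2.
HB.instance Definition _ :=
  isMeasurableFun.Build _ _ _ _ diagonal measurable_diagonal.

Local Open Scope ereal_scope.

Lemma indep_generated_bound (E : set (T1 * T2)) (e : \bar R) :
  measurable E -> 0 <= e -> (forall x, P [set y | E (x, y)] <= e) ->
  P [set w | E (w, w)] <= e.
Proof.
move=> mE e0 Ee.
pose P1 : probability T1 R := distribution P coarsen1.
pose P2 : probability T2 R := distribution P coarsen2.
have -> : P [set w | E (w, w)] = (P1 \x P2) E.
  rewrite (@product_measure_unique _ _ _ _ _ P1 P2 (distribution P diagonal))//.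
rewrite /product_measure1.
apply: (@le_trans _ _ (\int[P1]_x e)).
  apply: ge0_le_integral => //=; first exact: measurable_fun_xsection.
  move=> x _; rewrite /distribution /pushforward /=.
  apply: le_trans (Ee x); rewrite /xsection /preimage/=.
  by under eq_set do rewrite inE.
by rewrite integral_cst//= [X in _ * X]probability_setT mule1.
Qed.

End indep_generated_bound.

(** * Frames and operator norms *)

Section linear_algebra.
Context {R : realType}.
Local Notation C := R[i].

Lemma mulJc (z : C) : z^* * z = (normc z ^+ 2)%:C.
Proof. by rewrite mulrC -sqr_normc rmorphXn. Qed.

Lemma l2norm_dot k (v : 'cV[C]_k) : (l2norm v ^+ 2)%:C = (v^t* *m v) 0 0.
Proof.
rewrite sqr_l2norm rmorph_sum mxE; apply: eq_bigr => i _.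
by rewrite !mxE; exact/esym/mulJc.
Qed.

Lemma l2norm_1x1 (A : 'cV[C]_1) : l2norm A = normc (A 0 0).
Proof. by rewrite /l2norm big_ord1 sqrtr_sqr ger0_norm// normc_ge0. Qed.

Lemma adjointM k l p (A : 'M[C]_(k, l)) (B : 'M[C]_(l, p)) :
  (A *m B)^t* = B^t* *m A^t*.
Proof. by rewrite trmx_mul map_mxM. Qed.

Lemma l2norm_isometry k l (Q : 'M[C]_(k, l)) (v : 'cV[C]_l) :
  Q^t* *m Q = 1%:M -> l2norm (Q *m v) = l2norm v.
Proof.
move=> QQ; apply/eqP; rewrite -(@eqrXn2 _ 2)// ?l2norm_ge0//.
apply/eqP/complexI; rewrite !l2norm_dot adjointM mulmxA.
by rewrite -(mulmxA _ _ Q) QQ mulmx1.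
Qed.

Lemma mxOver_scalarsM F k l p (A : 'M[C]_(k, l)) (B : 'M[C]_(l, p)) :
  A \is a mxOver (scalars F) -> B \is a mxOver (scalars F) ->
  A *m B \is a mxOver (scalars F).
Proof.
case: F => /mxOverP AF /mxOverP BF; apply/mxOverP => i j //.
rewrite mxE unfold_in /=; apply: rpred_sum => h _.
exact: realM (AF i h) (BF h j).
Qed.

Section frame.
Variables (n m r : nat) (U : 'M[C]_(n, r)) (V : 'M[C]_(m, r)).
Hypotheses (UU : U^t* *m U = 1%:M) (VV : V^t* *m V = 1%:M).

Lemma frame_adjoint : (frame U V)^t* = block_mx (U^t*) 0 0 (V^t*).
Proof. by rewrite /frame tr_block_mx !trmx0 map_block_mx !map_mx0. Qed.

Lemma frame_isometry : (frame U V)^t* *m frame U V = 1%:M.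
Proof.
rewrite frame_adjoint mulmx_block !mul0mx !mulmx0 !addr0 !add0r UU VV.
by rewrite -scalar_mx_block.
Qed.

(** The blocks of [Pi] are scalar, so they commute with the frame and only
    [U^* U = 1] and [V^* V = 1] remain. *)
Lemma frame_phi_block mu (c : R) (z : C) :
  (frame U V)^t* *m phi_block mu c n m z *m frame U V = phi_block mu c r r z.
Proof.
rewrite frame_adjoint !mulmx_block !(mul0mx, mulmx0, addr0, add0r).
by rewrite !mul_mx_scalar -!scalemxAl UU VV !scalemx1.
Qed.

Lemma frame_unit_vectors F p : stiefel F U -> stiefel F V ->
  unit_vectors F p -> unit_vectors F (frame U V *m p).
Proof.
move=> [UF _] [VF _] [pF p1]; split; last first.
  by rewrite l2norm_isometry//; exact: frame_isometry.
apply: mxOver_scalarsM => //; apply/mxOverP => i j.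
have F0 : (0 : C) \in scalars F by case: F {UF VF pF}; rewrite ?inE ?rpred0.
move: UF VF => /mxOverP UF /mxOverP VF.
rewrite /frame mxE.
by case: (fintype.split i) => i'; rewrite mxE; case: (fintype.split j) => j' //;
  rewrite mxE.
Qed.

End frame.

Lemma normc_sum_le (I : finType) (f : I -> C) :
  normc (\sum_i f i) <= \sum_i normc (f i).
Proof.
elim/big_rec2: _ => [|j x y _ xy]; first by rewrite normc0.
by apply: le_trans (le_normcD _ _) _; rewrite lerD2l.
Qed.

Lemma normc_entry_le k (v : 'cV[C]_k) i : normc (v i 0) <= l2norm v.
Proof.
rewrite -(@ler_pXn2r _ 2)// ?nnegrE ?normc_ge0 ?l2norm_ge0//.
rewrite sqr_l2norm (bigD1 i)//= lerDl sumr_ge0// => j _; exact: sqr_ge0.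
Qed.

(** Only a crude bound on the image of the unit ball is needed: it makes the
    supremum finite, hence an upper bound of its set. *)
Lemma opnorm_le k l (A : 'M[C]_(k, l)) (e : R) :
  opnorm A <= e <-> forall v, l2norm v <= 1 -> l2norm (A *m v) <= e.
Proof.
pose M : R := \sum_(i < k) (\sum_(j < l) normc (A i j)) ^+ 2.
have l2b (v : 'cV[C]_l) : l2norm v <= 1 -> l2norm (A *m v) <= Num.sqrt M.
  move=> v1; apply: ler_wsqrtr; apply: ler_sum => i _.
  rewrite lerXn2r ?nnegrE ?normc_ge0 ?sumr_ge0// => [j _|].
    exact: normc_ge0.
  rewrite mxE; apply: le_trans (normc_sum_le _) _; apply: ler_sum => j _.
  rewrite normcM ler_piMr ?normc_ge0//; exact: le_trans (normc_entry_le v j) v1.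
have l20 : l2norm (0 : 'cV[C]_l) <= 1.
  rewrite /l2norm big1 ?sqrtr0 ?ler01// => i _.
  by rewrite mxE normc0 expr0n.
split=> [Ae v v1|h].
  apply: le_trans Ae; apply: sup_upper_bound; last by exists v.
  split; first by exists (l2norm (A *m 0)), 0.
  by exists (Num.sqrt M) => _ [u u1 <-]; exact: l2b.
apply: sup_le_ub; first by exists (l2norm (A *m 0)), 0.
by move=> _ [v v1 <-]; exact: h.
Qed.

End linear_algebra.

(** * The isotropic law along a random frame *)

Section measurability.
Context {R : realType}.
Local Notation C := R[i].

Lemma mx_measurable_comp d d' (T : measurableType d) (T' : measurableType d')
    k l (A : T' -> 'M[C]_(k, l)) (f : T -> T') :
  measurable_fun [set: T] f -> mx_measurable A -> mx_measurable (A \o f).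
Proof.
move=> mf mA i j; have [mRe mIm] := mA i j.
by split; [exact: (measurableT_comp mRe mf)|exact: (measurableT_comp mIm mf)].
Qed.

Lemma mx_events_measurable d (T : measurableType d) k l
    (A : T -> 'M[C]_(k, l)) : mx_measurable A -> mx_events A `<=` measurable.
Proof.
move=> mA E [i [j [B mB]]]; have [mRe mIm] := mA i j.
by move=> [] ->; rewrite -[X in measurable X]setTI; [exact: mRe|exact: mIm].
Qed.

Lemma mx_measurable_g_sigma_algebra d (T : measurableType d) k l
    (A : T -> 'M[C]_(k, l)) (G : set (set T)) : mx_events A `<=` G ->
  mx_measurable (A : g_sigma_algebraType G -> 'M[C]_(k, l)).
Proof.
move=> AG i j; split=> _ B mB; rewrite setTI;
  apply: (@sub_sigma_algebra _ setT G); apply: AG;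
  exists i, j, B => //.
- by left.
- by right.
Qed.

Section events.
Context d (T : measurableType d) (n m : nat).
Variables (mu : probability (measurableTypeR R) R) (c : R) (K : set C^o).
Variable X : T -> 'M[C]_(n, m).
Hypotheses (mX : mx_measurable X) (cK : compact K).

Let S_alg := @measurable_function_algebra R d T.

Lemma measurable_hermitization : mx_measurable (fun w => hermitization (X w)).
Proof.
apply: mxalg_block; [exact: mxalg_cst|exact: mX|exact: mxalg_adjoint|].
exact: mxalg_cst.
Qed.

Lemma measurable_bilinear_event (p q : T -> 'cV[C]_(n + m)) e : 0 <= e ->
  mx_measurable p -> mx_measurable q ->
  measurable [set w | (e%:E <
    resolvent_sup (hermitization (X w)) K (bilinear_error mu c (p w) (q w)))%E].
Proof.
move=> e0 mp mq; rewrite -[X in measurable X]setCK; apply: measurableC.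
have mpt : mx_measurable (fun w => (p w)^t*) by exact: mxalg_adjoint.
have := measurable_resolvent_event (phi_block mu c n m) [set 1%:M]
  cK measurable_hermitization mpt mq e0.
congr (measurable _); apply/seteqP; split => w /=.
  move=> h; apply/negP; rewrite -leNgt; apply/resolvent_sup_le => z /h[u hz].
  split=> //; rewrite /bilinear_error -l2norm_1x1 -[X in l2norm X]mulmx1.
  exact: hz.
move=> /negP; rewrite -leNgt => /resolvent_sup_le h z /h[u hz].
by split=> // _ ->; rewrite mulmx1 l2norm_1x1.
Qed.

Lemma measurable_opnorm_event r (U : T -> 'M[C]_(n, r)) (V : T -> 'M[C]_(m, r))
    e : 0 <= e -> mx_measurable U -> mx_measurable V ->
  (forall w, (U w)^t* *m U w = 1%:M) -> (forall w, (V w)^t* *m V w = 1%:M) ->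
  measurable [set w | (resolvent_sup (hermitization (X w)) K
        (fun z G => opnorm ((frame (U w) (V w))^t* *m G
           *m frame (U w) (V w) - phi_block mu c r r z)) <= e%:E)%E].
Proof.
move=> e0 mU mV UU VV.
have mE : mx_measurable (fun w => frame (U w) (V w)).
  by apply: mxalg_block => //; exact: mxalg_cst.
have mEt : mx_measurable (fun w => (frame (U w) (V w))^t*).
  exact: mxalg_adjoint.
have := measurable_resolvent_event (phi_block mu c n m) [set v | l2norm v <= 1]
  cK measurable_hermitization mEt mE e0.
congr (measurable _); apply/seteqP; split => w /= h.
  apply/resolvent_sup_le => z /h[u hz]; split=> //; apply/opnorm_le => v v1.
  rewrite -(frame_phi_block (UU w) (VV w)) -mulmxBl -mulmxBr; exact: hz.
move: h => /resolvent_sup_le h z /h[u /opnorm_le hz]; split=> // v /hz.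
by rewrite -(frame_phi_block (UU w) (VV w)) -mulmxBl -mulmxBr.
Qed.

End events.

(** For fixed [w], the frame maps [p] and [q] to vectors covered by the isotropic
    law; the law may be averaged over [w] because the frame is constant or
    independent of [X]. *)
Lemma frame_bilinear_bound d (T : measurableType d) (P : probability T R)
    (F : scalar_field) n m r (X : T -> 'M[C]_(n, m))
    (U : T -> 'M[C]_(n, r)) (V : T -> 'M[C]_(m, r))
    (mu : probability (measurableTypeR R) R) (c : R) (K : set C^o) (e : R)
    (eta : \bar R) (p q : 'cV[C]_(r + r)) :
  mx_measurable X -> mx_measurable U -> mx_measurable V ->
  (forall w, stiefel F (U w) /\ stiefel F (V w)) ->
  deterministic (fun w => (U w, V w)) \/
    indep_generated P (mx_events X) (mx_events U `|` mx_events V) ->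
  compact K -> 0 <= e -> (0 <= eta)%E ->
  unit_vectors F p -> unit_vectors F q ->
  (forall p q : 'cV[C]_(n + m), unit_vectors F p -> unit_vectors F q ->
    P [set w | e%:E < resolvent_sup (hermitization (X w)) K
                        (bilinear_error mu c p q)] <= eta)%E ->
  (P [set w | e%:E < resolvent_sup (hermitization (X w)) K
       (bilinear_error mu c (frame (U w) (V w) *m p) (frame (U w) (V w) *m q))]
    <= eta)%E.
Proof.
move=> mX mU mV UV detind cK e0 eta0 p1 q1 law.
have Eunit w v : unit_vectors F v -> unit_vectors F (frame (U w) (V w) *m v).
  by have [Us Vs] := UV w; apply: frame_unit_vectors => //; [case: Us|case: Vs].
case: detind => [[[u v] uv]|ind].
  have Uu w : U w = u by case: (uv w).
  have Vv w : V w = v by case: (uv w).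
  under eq_set do rewrite Uu Vv.
  apply: law; rewrite -(Uu point) -(Vv point); exact: Eunit.
pose GX := mx_events X; pose GE := mx_events U `|` mx_events V.
pose T1 := g_sigma_algebraType GE; pose T2 := g_sigma_algebraType GX.
have mGE : GE `<=` measurable.
  by move=> A [] /mx_events_measurable; exact.
have indC : indep_generated P GE GX.
  by move=> B1 B2 s1 s2; rewrite setIC muleC; exact: ind.
pose E := [set x : T1 * T2 | (e%:E < resolvent_sup (hermitization (X x.2)) K
  (bilinear_error mu c (frame (U x.1) (V x.1) *m p)
                       (frame (U x.1) (V x.1) *m q)))%E].
apply: (indep_generated_bound mGE (mx_events_measurable mX) indC (E := E)) => //.
  have S_alg := @measurable_function_algebra R _ (T1 * T2)%type.
  have mX2 : mx_measurable (fun x : T1 * T2 => X x.2).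
    apply: (mx_measurable_comp (A := X : T2 -> _) measurable_snd).
    exact: mx_measurable_g_sigma_algebra.
  have mU1 : mx_measurable (fun x : T1 * T2 => U x.1).
    apply: (mx_measurable_comp (A := U : T1 -> _) measurable_fst).
    by apply: mx_measurable_g_sigma_algebra => A; left.
  have mV1 : mx_measurable (fun x : T1 * T2 => V x.1).
    apply: (mx_measurable_comp (A := V : T1 -> _) measurable_fst).
    by apply: mx_measurable_g_sigma_algebra => A; right.
  have mE : mx_measurable (fun x : T1 * T2 => frame (U x.1) (V x.1)).
    by apply: mxalg_block => //; exact: mxalg_cst.
  apply: measurable_bilinear_event => //; apply: mxalgM => //;
  exact: mxalg_cst.
move=> w; exact: (law _ _ (Eunit w p p1) (Eunit w q q1)).
Qed.

End measurability.

(** * A net of exponential cardinality *)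

Lemma truncation_error (R : realType) (y : R) :
  `|y - (-1) ^+ (y < 0)%R * (Num.truncn `|y|)%:R| <= 1.
Proof.
have := truncn_itv (normr_ge0 y); rewrite -natr1.
have [y0|y0] := ltP y 0.
  rewrite [_ ^+ true]expr1 mulN1r ltr0_norm// => /andP[? ?].
  by rewrite ler_norml; apply/andP; split; lra.
rewrite [_ ^+ false]expr0 mul1r ger0_norm// => /andP[? ?].
by rewrite ler_norml; apply/andP; split; lra.
Qed.

Section net.
Context {R : realType} (k : nat).
Local Notation C := R[i].

(** An integer vector is encoded by signs and absolute values; zero entries have
    two encodings, which only enlarges the net.  In dimension [k] the points of
    norm at most [4 sqrt k] have entries at most [16 k], as an integer is at most
    its square. *)
Definition grid : finType := {ffun 'I_k -> bool * 'I_(16 * k).+1}.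

Definition grid_vector (x : grid) : 'cV[R]_k :=
  \col_i ((-1) ^+ (x i).1 * (x i).2%:R).

Definition net : {set grid} :=
  [set x : grid | (\sum_i (x i).2 ^ 2 <= 16 * k)%N & grid_vector x != 0].

(** A weighted count: a net point has [sum |x_i| <= sum x_i^2 <= 16 k], hence
    weight [2 ^ - sum |x_i|] at least [2 ^ - 16 k], while the weights of all grid
    points add up to the [k]-th power of a geometric sum that is at most [4]. *)
Lemma card_net : (#|net| <= 2 ^ (18 * k))%N.
Proof.
pose wt (a : bool * 'I_(16 * k).+1) : R := 2^-1 ^+ a.2.
have geo n : \sum_(j < n) (2^-1 : R) ^+ j <= 2.
  suff -> : \sum_(j < n) (2^-1 : R) ^+ j = 2 - 2 * 2^-1 ^+ n.
    by rewrite gerBl mulr_ge0// exprn_ge0// invr_ge0.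
  elim: n => [|n IH]; first by rewrite big_ord0 expr0; lra.
  by rewrite big_ord_recr/= IH exprS; lra.
have wt4 : \sum_a wt a <= 4.
  rewrite -(pair_bigA _ (fun (_ : bool) (j : 'I_(16 * k).+1) => 2^-1 ^+ j))/=.
  rewrite big_bool/=; have := geo (16 * k).+1; lra.
have wt0 a : 0 <= wt a by rewrite exprn_ge0// invr_ge0.
have wtx (x : grid) : x \in net -> 1 <= 2 ^+ (16 * k) * \prod_i wt (x i).
  rewrite inE => /andP[xk _].
  rewrite /wt -expr_sum exprVn -[X in X <= _](@mulfV _ (2 ^+ (\sum_i (x i).2)%N))
    ?expf_neq0// ler_wpM2r// ?invr_ge0 ?exprn_ge0//.
  rewrite ler_eXn2l ?ltr1n//; apply: leq_trans xk; apply: leq_sum => i _.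
  by case: (nat_of_ord _) => // j; rewrite expnS leq_pmulr.
rewrite -(ler_nat R) -sum1_card natr_sum.
apply: (@le_trans _ _ (\sum_(x in net) 2 ^+ (16 * k) * \prod_i wt (x i))).
  by apply: ler_sum => x /wtx.
apply: (@le_trans _ _ (\sum_(x : grid) 2 ^+ (16 * k) * \prod_i wt (x i))).
  rewrite [leRHS](bigID (mem net))/= lerDl sumr_ge0// => x _.
  by rewrite mulr_ge0 ?exprn_ge0// prodr_ge0.
rewrite -mulr_sumr -(bigA_distr_bigA (fun=> wt)) prodr_const card_ord.
rewrite (_ : (18 * k = 16 * k + 2 * k)%N); last by rewrite -mulnDl.
rewrite natrX exprD ler_wpM2l ?exprn_ge0// exprM.
rewrite lerXn2r ?nnegrE ?sumr_ge0 ?exprn_ge0//.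
by apply: le_trans wt4 _; rewrite expr2; lra.
Qed.

Definition toC (f : 'cV[R]_k) : 'cV[C]_k := map_mx (real_complex R) f.

Lemma sqr_l2norm_toC f : l2norm (toC f) ^+ 2 = \sum_i f i 0 ^+ 2.
Proof.
rewrite sqr_l2norm; apply: eq_bigr => i _.
by rewrite mxE /= expr0n/= addr0 sqrtr_sqr real_normK ?num_real.
Qed.

Lemma l2norm_toC_le f e : 0 <= e ->
  (l2norm (toC f) <= e) = (\sum_i f i 0 ^+ 2 <= e ^+ 2).
Proof. by move=> e0; rewrite -sqr_l2norm_toC ler_pXn2r// nnegrE l2norm_ge0. Qed.

Definition rounding (x : grid) : 'cV[R]_k :=
  (4 * Num.sqrt k%:R)^-1 *: grid_vector x.

(** Rounding [4 sqrt k f] entrywise towards zero does not increase the norm, and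
    the [k] errors, at most [1 / (4 sqrt k)] each, add up to a vector of norm at
    most [1/4]; the factor [4] brings that vector back to the unit ball. *)
Lemma exists_rounding (f : 'cV[R]_k) : l2norm (toC f) <= 1 ->
  exists x : grid, [/\ (\sum_i (x i).2 ^ 2 <= 16 * k)%N,
    l2norm (toC (rounding x)) <= 1 & l2norm (toC (4 *: (f - rounding x))) <= 1].
Proof.
rewrite l2norm_toC_le ?ler01// expr1n => f1.
pose s : R := 4 * Num.sqrt k%:R.
have s0 : 0 <= s by rewrite mulr_ge0 ?sqrtr_ge0.
have s2 : s ^+ 2 = 16 * k%:R.
  by rewrite exprMn sqr_sqrtr ?ler0n//; congr (_ * _); ring.
pose t i := Num.truncn `|s * f i 0|.
have tP i : (t i)%:R <= `|s * f i 0| < (t i).+1%:R by exact: truncn_itv.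
have t2 i : (t i)%:R ^+ 2 <= s ^+ 2 * f i 0 ^+ 2.
  rewrite -exprMn -[leRHS]real_normK ?num_real// lerXn2r ?nnegrE//.
  by have /andP[] := tP i.
have tk : (\sum_i t i ^ 2 <= 16 * k)%N.
  rewrite -(ler_nat R) natr_sum natrM -s2.
  apply: (@le_trans _ _ (s ^+ 2 * \sum_i f i 0 ^+ 2)).
    by rewrite mulr_sumr; apply: ler_sum => i _; rewrite natrX.
  by rewrite ler_piMr// exprn_ge0.
have tN i : (t i < (16 * k).+1)%N.
  rewrite ltnS; apply: leq_trans tk; rewrite (bigD1 i)//=.
  apply: leq_trans (leq_addr _ _).
  by case: (t i) => // j; rewrite expnS leq_pmulr.
pose x : grid := [ffun i => (s * f i 0 < 0, Ordinal (tN i))].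
have xE i : grid_vector x i 0 = (-1) ^+ (s * f i 0 < 0)%R * (t i)%:R.
  by rewrite mxE ffunE.
have k0 (i : 'I_k) : 0 < s.
  by rewrite mulr_gt0// sqrtr_gt0 ltr0n; case: (k) i => [[]|].
exists x; split.
- by under eq_bigr do rewrite ffunE.
- rewrite l2norm_toC_le ?ler01// expr1n; apply: le_trans f1.
  apply: ler_sum => i _; rewrite mxE exprMn xE exprMn sqrr_sign mul1r exprVn.
  by rewrite mulrC ler_pdivrMr ?exprn_gt0 ?(k0 i)// mulrC.
- rewrite l2norm_toC_le ?ler01// expr1n.
  apply: (@le_trans _ _ (\sum_(i < k) k%:R^-1)); last first.
    rewrite sumr_const card_ord -[leLHS]mulr_natr.
    by have [->|k1] := eqVneq k 0%N; rewrite ?mulr0 ?ler01// mulVf ?pnatr_eq0.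
  apply: ler_sum => i _; have si := k0 i.
  have xi : `|s * f i 0 - grid_vector x i 0| <= 1.
    by rewrite xE; exact: truncation_error.
  have -> : (4 *: (f - rounding x)) i 0 =
      (4 / s) * (s * f i 0 - grid_vector x i 0).
    by rewrite !mxE -/s; field; rewrite gt_eqF.
  rewrite exprMn -[X in _ * X]real_normK ?num_real// exprMn exprVn s2.
  have kk : 0 < k%:R :> R by rewrite ltr0n; case: (k) i {si xi} => [[]|].
  apply: (@le_trans _ _ (4 ^+ 2 * (16 * k%:R)^-1)).
    rewrite ler_piMr ?exprn_ile1// mulr_ge0 ?invr_ge0 ?mulr_ge0 ?(ltW kk)//.
  rewrite invfM mulrA (_ : 4 ^+ 2 / 16 = 1) ?mul1r//; by field.
Qed.

End net.

Arguments net R k : clear implicits.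

(** * Operator norms on the net *)

Section opnorm_net.
Context {R : realType} (k : nat).
Local Notation C := R[i].
Local Notation grid_vector := (@grid_vector R k).
Local Notation rounding := (@rounding R k).

Definition direction (x : grid k) : 'cV[C]_k :=
  toC ((l2norm (toC (grid_vector x)))^-1 *: grid_vector x).

Lemma l2norm_toC_eq0 (f : 'cV[R]_k) : l2norm (toC f) = 0 -> f = 0.
Proof.
move=> f0; have : \sum_i f i 0 ^+ 2 == 0 by rewrite -sqr_l2norm_toC f0 expr0n.
rewrite psumr_eq0 => [/allP fi|i _]; last exact: sqr_ge0.
apply/colP => i; rewrite mxE; apply/eqP; rewrite -sqrf_eq0.
by apply: (implyP (fi i _)); rewrite ?mem_index_enum.
Qed.

Lemma toCZ (s : R) (f : 'cV[R]_k) : toC (s *: f) = s%:C *: toC f.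
Proof. exact: map_mxZ. Qed.

Lemma toCD (f g : 'cV[R]_k) : toC (f + g) = toC f + toC g.
Proof. exact: map_mxD. Qed.

Lemma normc_real (s : R) : normc s%:C = `|s|.
Proof. by rewrite /= expr0n/= addr0 sqrtr_sqr. Qed.

Lemma toC_scalars F (f : 'cV[R]_k) : toC f \is a mxOver (scalars F).
Proof.
apply/mxOverP => i j; rewrite mxE; case: F => //.
by rewrite inE complex_real.
Qed.

Lemma direction_unit_vectors F x : x \in net R k -> unit_vectors F (direction x).
Proof.
rewrite inE => /andP[_ x0]; split; first exact: toC_scalars.
have nx0 : l2norm (toC (grid_vector x)) != 0.
  by apply/eqP => /l2norm_toC_eq0 z0; rewrite z0 eqxx in x0.
rewrite /direction toCZ l2normZ normc_real.
by rewrite ger0_norm ?invr_ge0 ?l2norm_ge0// mulVf.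
Qed.

Variable M : 'M[C]_k.

Let form (u v : 'cV[C]_k) : C := (u^t* *m M *m v) 0 0.

Let formDl u u' v : form (u + u') v = form u v + form u' v.
Proof. by rewrite /form linearD map_mxD !mulmxDl mxE. Qed.

Let formDr u v v' : form u (v + v') = form u v + form u v'.
Proof. by rewrite /form mulmxDr mxE. Qed.

Let formZl a u v : form (a *: u) v = a^* * form u v.
Proof. by rewrite /form linearZ map_mxZ -!scalemxAl mxE. Qed.

Let formZr a u v : form u (a *: v) = a * form u v.
Proof. by rewrite /form -scalemxAr mxE. Qed.

Let normcJ (z : C) : normc z^* = normc z.
Proof. by case: z => x y /=; rewrite sqrrN. Qed.

Let form_direction x y :
  normc (form (toC (grid_vector x)) (toC (grid_vector y))) =
  l2norm (toC (grid_vector x)) * l2norm (toC (grid_vector y)) *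
  normc (form (direction x) (direction y)).
Proof.
have dir z : toC (grid_vector z) =
    (l2norm (toC (grid_vector z)))%:C *: direction z.
  rewrite /direction -toCZ scalerA.
  have [z0|z0] := eqVneq (l2norm (toC (grid_vector z))) 0; last first.
    by rewrite mulfV ?scale1r.
  by rewrite z0 mul0r scale0r (l2norm_toC_eq0 z0).
rewrite {1}(dir x) {1}(dir y) formZl formZr !normcM normcJ !normc_real.
by rewrite !ger0_norm ?l2norm_ge0// mulrA.
Qed.

(* A crude bound, for the finiteness of the supremum only. *)
Let ball_form_bounded (f g : 'cV[R]_k) :
  l2norm (toC f) <= 1 -> l2norm (toC g) <= 1 ->
  normc (form (toC f) (toC g)) <= \sum_j \sum_i normc (M i j).
Proof.
move=> f1 g1; rewrite /form mxE; apply: le_trans (normc_sum_le _) _.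
apply: ler_sum => j _; rewrite normcM mxE.
apply: (@le_trans _ _ (normc (\sum_i (toC f)^t* 0 i * M i j))).
  rewrite ler_piMr ?normc_ge0//; exact: le_trans (normc_entry_le _ _) g1.
apply: le_trans (normc_sum_le _) _; apply: ler_sum => i _.
rewrite normcM ler_piMl ?normc_ge0// !mxE normcJ.
by have := le_trans (normc_entry_le (toC f) i) f1; rewrite mxE.
Qed.

Let ball_values : set R :=
  [set x | exists f g, [/\ l2norm (toC f) <= 1, l2norm (toC g) <= 1 &
     x = normc (form (toC f) (toC g))]].

Let ball_form_sup (f g : 'cV[R]_k) :
  l2norm (toC f) <= 1 -> l2norm (toC g) <= 1 ->
  normc (form (toC f) (toC g)) <= sup ball_values.
Proof.
move=> f1 g1; apply: sup_upper_bound; last by exists f, g.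
split; first by exists (normc (form (toC f) (toC g))), f, g.
exists (\sum_j \sum_i normc (M i j)) => _ [f' [g' [f1' g1' ->]]].
exact: ball_form_bounded.
Qed.

Let l2norm0 : l2norm (toC (0 : 'cV[R]_k)) = 0.
Proof. by rewrite -(scale0r (0 : 'cV[R]_k)) toCZ l2normZ normc0 mul0r. Qed.

Let sup_ge0 : 0 <= sup ball_values.
Proof.
apply: le_trans (ball_form_sup (f := 0) (g := 0) _ _); first exact: normc_ge0.
all: by rewrite l2norm0 ler01.
Qed.

Let real_form_le (f g : 'cV[R]_k) : normc (form (toC f) (toC g)) <=
  sup ball_values * (l2norm (toC f) * l2norm (toC g)).
Proof.
have normalize (h : 'cV[R]_k) : exists2 h' : 'cV[R]_k,
    toC h = (l2norm (toC h))%:C *: toC h' &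
    l2norm (toC h') <= 1.
  have [h0|h0] := eqVneq (l2norm (toC h)) 0.
    exists 0; last by rewrite l2norm0 ler01.
    by rewrite -toCZ scaler0 (l2norm_toC_eq0 h0).
  exists ((l2norm (toC h))^-1 *: h).
    by rewrite -toCZ scalerA mulfV// scale1r.
  by rewrite toCZ l2normZ normc_real ger0_norm ?invr_ge0 ?l2norm_ge0// mulVf.
have [f' ff' f1] := normalize f; have [g' gg' g1] := normalize g.
rewrite {1}ff' {1}gg' formZl formZr !normcM normcJ !normc_real.
rewrite !ger0_norm ?l2norm_ge0// mulrA mulrC.
by rewrite ler_wpM2r ?mulr_ge0 ?l2norm_ge0//; exact: ball_form_sup.
Qed.

(* The four pairs of real and imaginary parts account for the factor [4]. *)
Let complex_form_le u v :
  normc (form u v) <= 4 * sup ball_values * (l2norm u * l2norm v).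
Proof.
pose re (w : 'cV[C]_k) := map_mx (@complex.Re R) w.
pose im (w : 'cV[C]_k) := map_mx (@complex.Im R) w.
have decomp w : w = toC (re w) + 'i *: toC (im w).
  by apply/colP => i; rewrite !mxE -complexE.
have part w (p : C -> R) : (forall z, p z ^+ 2 <= normc z ^+ 2) ->
    l2norm (toC (map_mx p w)) <= l2norm w.
  move=> pz; rewrite l2norm_toC_le ?l2norm_ge0// sqr_l2norm.
  by apply: ler_sum => i _; rewrite mxE.
have rew w : l2norm (toC (re w)) <= l2norm w.
  apply: part => -[x y] /=; rewrite sqr_sqrtr ?addr_ge0 ?sqr_ge0//.
  by rewrite lerDl sqr_ge0.
have imw w : l2norm (toC (im w)) <= l2norm w.
  apply: part => -[x y] /=; rewrite sqr_sqrtr ?addr_ge0 ?sqr_ge0//.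
  by rewrite lerDr sqr_ge0.
have term f g : l2norm (toC f) <= l2norm u -> l2norm (toC g) <= l2norm v ->
    normc (form (toC f) (toC g)) <= sup ball_values * (l2norm u * l2norm v).
  move=> fu gv; apply: le_trans (real_form_le f g) _.
  by rewrite ler_wpM2l// ler_pM// l2norm_ge0.
have i1 : normc ('i : C) = 1.
  by rewrite /= expr0n/= add0r expr1n sqrtr1.
rewrite {1}(decomp u) {1}(decomp v) formDl !formDr !formZl !formZr.
set B := sup ball_values * _ in term *.
rewrite (_ : 4 * _ * _ = (B + B) + (B + B)); last by rewrite /B; ring.
do !(apply: le_trans (le_normcD _ _) _; apply: lerD).
all: by rewrite ?normcM ?normcJ ?i1 ?mul1r; apply: term.
Qed.

(** Let [S] be the supremum of the form over real unit balls.  Replacing both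
    arguments by their roundings costs [S/4] each, and on the roundings the form
    is at most [a]; so [S <= a + S/2], that is [S <= 2 a].  Passing to complex
    vectors multiplies this by [4]. *)
Lemma opnorm_net a : 0 <= a ->
  (forall x y, x \in net R k -> y \in net R k ->
     normc (((direction x)^t* *m M *m direction y) 0 0) <= a) ->
  opnorm M <= 8 * a.
Proof.
move=> a0 netM; pose S := sup ball_values.
have rounding_le (x y : grid k) : (\sum_i (x i).2 ^ 2 <= 16 * k)%N ->
    (\sum_i (y i).2 ^ 2 <= 16 * k)%N ->
    l2norm (toC (rounding x)) <= 1 -> l2norm (toC (rounding y)) <= 1 ->
    normc (form (toC (rounding x)) (toC (rounding y))) <= a.
  move=> xk yk; rewrite /rounding !toCZ !l2normZ !normc_real => x1 y1.
  rewrite formZl formZr !normcM normcJ !normc_real form_direction.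
  have [x0|x0] := eqVneq (grid_vector x) 0.
    by rewrite x0 l2norm0 !(mul0r, mulr0).
  have [y0|y0] := eqVneq (grid_vector y) 0.
    by rewrite y0 l2norm0 !(mul0r, mulr0).
  have xn : x \in net R k by rewrite inE xk.
  have yn : y \in net R k by rewrite inE yk.
  have := netM _ _ xn yn; rewrite -/(form _ _) => Ma.
  set s := `|_| in x1 y1 *.
  set lx := l2norm _ in x1 *; set ly := l2norm _ in y1 *.
  rewrite (_ : _ * _ = (s * lx) * (s * ly) *
      normc (form (direction x) (direction y))); last by ring.
  apply: le_trans Ma; rewrite ler_piMl ?normc_ge0// mulr_ile1//;
  by rewrite mulr_ge0 ?normr_ge0 ?l2norm_ge0.
have S2 : S <= 2 * a.
  suff : S <= a + (4^-1 * S + 4^-1 * S) by move=> ?; lra.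
  apply: sup_le_ub.
    by exists (normc (form (toC 0) (toC 0))), 0, 0; rewrite l2norm0 ler01.
  move=> _ [f [g [f1 g1 ->]]].
  have [x [xk x1 fx]] := exists_rounding f1.
  have [y [yk y1 gy]] := exists_rounding g1.
  have quarter (h : 'cV[R]_k) : toC h = (4^-1)%:C *: toC (4 *: h).
    by rewrite -toCZ scalerA mulVf ?scale1r.
  have split4 (h h' : 'cV[R]_k) :
      toC h = toC h' + (4^-1)%:C *: toC (4 *: (h - h')).
    by rewrite -quarter -toCD addrC subrK.
  rewrite (split4 f (rounding x)) formDl (split4 g (rounding y)) formDr -addrA.
  rewrite -(split4 g (rounding y)).
  rewrite formZl formZr.
  apply: le_trans (le_normcD _ _) _; apply: lerD; first exact: rounding_le.
  apply: le_trans (le_normcD _ _) _; apply: lerD.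
    rewrite normcM normc_real ger0_norm ?invr_ge0// ler_wpM2l ?invr_ge0//.
    exact: ball_form_sup.
  rewrite normcM normcJ normc_real ger0_norm ?invr_ge0// ler_wpM2l ?invr_ge0//.
  exact: ball_form_sup.
(* Testing the form on [u = M v] yields [|u|^2]. *)
apply/opnorm_le => v v1; set u := M *m v.
have uu : l2norm u ^+ 2 = normc (form u v).
  by rewrite /form -mulmxA -l2norm_dot normc_real ger0_norm ?sqr_ge0.
have := complex_form_le u v; rewrite -uu expr2 => h.
have [u0|u0] := eqVneq (l2norm u) 0; first by rewrite u0 mulr_ge0.
have up : 0 < l2norm u by rewrite lt_def u0 l2norm_ge0.
rewrite -(ler_pM2l up); apply: (le_trans h).
rewrite mulrCA ler_wpM2l ?l2norm_ge0//.
apply: (@le_trans _ _ (4 * S * 1)); last by lra.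
by rewrite ler_wpM2l// mulr_ge0.
Qed.

End opnorm_net.

(** * The union bound *)

Lemma unit_vectors_nonempty (R : realType) (F : scalar_field) k :
  (0 < k)%N -> exists p, @unit_vectors R F k p.
Proof.
move=> k0; pose i := Ordinal k0; exists (toC (delta_mx i 0)).
split; first exact: toC_scalars.
apply/eqP; rewrite -(@eqrXn2 _ 2)// ?l2norm_ge0// sqr_l2norm_toC (bigD1 i)//=.
rewrite big1 ?mxE ?eqxx ?addr0// => j /negbTE ji.
by rewrite mxE ji expr0n.
Qed.

Lemma measure_union_bound (R : realType) d (T : measurableType d)
    (mu : {measure set T -> \bar R}) (I : eqType) (s : seq I) (A : I -> set T)
    (e : R) : (forall i, i \in s -> measurable (A i) /\ (mu (A i) <= e%:E)%E) ->
  measurable (\big[setU/set0]_(i <- s) A i) /\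
  (mu (\big[setU/set0]_(i <- s) A i) <= ((size s)%:R * e)%:E)%E.
Proof.
elim: s => [|i s IH] As.
  by rewrite big_nil measure0 mul0r; split=> //; exact: measurable0.
have [j js|ms us] := IH; first by apply: As; rewrite inE js orbT.
have [mi ui] := As i (mem_head i s).
rewrite big_cons; split; first exact: measurableU.
apply: le_trans (measureU2 _ _ _) _ => //.
by rewrite /= -natr1 mulrDl mul1r addrC EFinD; exact: leeD.
Qed.

Section opnorm_tail.
Context {R : realType} d (T : measurableType d) (P : probability T R).
Variables (F : scalar_field) (n m r : nat) (X : T -> 'M[R[i]]_(n, m)).
Variables (U : T -> 'M[R[i]]_(n, r)) (V : T -> 'M[R[i]]_(m, r)).
Variables (mu : probability (measurableTypeR R) R) (c : R) (K : set R[i]^o).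

(** Besides one bad event for each pair of net points, there is one for a fixed
    unit vector [p]: it covers the points at which the resolvent does
    not exist, also when [r = 0] and the net is empty.  The number of pairs is at
    most the square of [2 ^ (18 * 2 r)]. *)
Lemma opnorm_tail (e eta : R) : (0 < n + m)%N ->
  mx_measurable X -> mx_measurable U -> mx_measurable V ->
  (forall w, stiefel F (U w) /\ stiefel F (V w)) ->
  deterministic (fun w => (U w, V w)) \/
    indep_generated P (mx_events X) (mx_events U `|` mx_events V) ->
  compact K -> 0 <= e -> 0 <= eta ->
  (forall p q : 'cV[R[i]]_(n + m), unit_vectors F p -> unit_vectors F q ->
    P [set w | e%:E < resolvent_sup (hermitization (X w)) K
                        (bilinear_error mu c p q)] <= eta%:E)%E ->
  let good := [set w | (resolvent_sup (hermitization (X w)) K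
        (fun z G => opnorm ((frame (U w) (V w))^t* *m G
           *m frame (U w) (V w) - phi_block mu c r r z)) <= (8 * e)%:E)%E] in
  measurable good /\ (P (~` good) <= ((2 ^+ (72 * r) + 1) * eta)%:E)%E.
Proof.
move=> nm0 mX mU mV UV ind cK e0 eta0 law good.
have UU w : (U w)^t* *m U w = 1%:M by case: (UV w) => -[].
have VV w : (V w)^t* *m V w = 1%:M by case: (UV w) => _ [].
have mgood : measurable good.
  by apply: measurable_opnorm_event => //; rewrite mulr_ge0.
split=> //.
pose bad (x : grid (r + r) * grid (r + r)) := [set w | (e%:E <
  resolvent_sup (hermitization (X w)) K (bilinear_error mu c
    (frame (U w) (V w) *m direction x.1)
    (frame (U w) (V w) *m direction x.2)))%E].
pose pairs := [seq (x, y) | x <- enum (net R (r + r)),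
                            y <- enum (net R (r + r))].
have S_alg := @measurable_function_algebra R d T.
have mE : mx_measurable (fun w => frame (U w) (V w)).
  by apply: mxalg_block => //; exact: mxalg_cst.
have [|mbad ubad] := @measure_union_bound _ _ _ P _ pairs bad eta.
  move=> _ /allpairsP[[x y] /= [xn yn ->]].
  rewrite mem_enum in xn; rewrite mem_enum in yn.
  split; last first.
    by apply: (frame_bilinear_bound mX mU mV UV ind) => //;
      rewrite ?lee_fin//; exact: direction_unit_vectors.
  apply: measurable_bilinear_event => //; apply: mxalgM => //;
  exact: mxalg_cst.
have [p pF] := unit_vectors_nonempty R F nm0.
pose singular := [set w | (e%:E <
  resolvent_sup (hermitization (X w)) K (bilinear_error mu c p p))%E].
have msing : measurable singular.
  by apply: measurable_bilinear_event => //; exact: mxalg_cst.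
have sub : ~` good `<=` \big[setU/set0]_(x <- pairs) bad x `|` singular.
  move=> w /= gw; apply: contrapT => /not_orP[nbad nsing]; apply: gw.
  move: nsing => /negP; rewrite -leNgt => /resolvent_sup_le inv.
  apply/resolvent_sup_le => z Kz; have [u _] := inv z Kz; split=> //.
  apply: opnorm_net => // x y xn yn.
  have : ~ bad (x, y) w.
    move=> bw; apply: nbad; rewrite -bigcup_seq; exists (x, y) => //=.
    by apply/allpairsP; exists (x, y); rewrite !mem_enum.
  move=> /negP; rewrite -leNgt => /resolvent_sup_le /(_ z Kz) [_].
  rewrite /bilinear_error -(frame_phi_block (UU w) (VV w)) -mulmxBl -mulmxBr.
  by rewrite adjointM !mulmxA.
apply: le_trans (le_measure _ _ _ sub) _; rewrite ?inE//.
- exact: measurableC.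
- exact: measurableU.
apply: le_trans (measureU2 _ _ _) _ => //.
rewrite mulrDl mul1r EFinD; apply: leeD; last exact: law.
apply: le_trans ubad _; rewrite lee_fin ler_wpM2r// size_allpairs -cardE.
rewrite -natrX ler_nat (_ : 72 * r = 18 * (r + r) + 18 * (r + r))%N.
  by rewrite expnD leq_mul// card_net.
by rewrite -mulnDr !addnn -!mul2n !mulnA.
Qed.

End opnorm_tail.

(** As [2 <= e], the number [2 ^ (72 r)] of pairs is at most
    [exp (72 |A| ln n) = n ^ (72 |A|)]. *)
Lemma net_cardinality_beaten (R : realType) (A : R) (n r : nat) : (0 < n)%N ->
  r%:R <= A * ln (n%:R : R) ->
  (2 ^+ (72 * r) + 1) * n%:R `^ (- (72 * `|A| + 1)) <= 2 / n%:R :> R.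
Proof.
move=> n0 rA; have n1 : 1 <= n%:R :> R by rewrite ler1n.
have np : 0 < n%:R :> R by rewrite ltr0n.
have ln0 : 0 <= ln (n%:R : R) by exact: ln_ge0.
have cardn : 2 ^+ (72 * r) <= n%:R `^ (72 * `|A|) :> R.
  rewrite /powR gt_eqF// -mulrA.
  apply: (@le_trans _ _ (expR 1 ^+ (72 * r))).
    rewrite lerXn2r ?nnegrE ?expR_ge0//.
    by apply: le_trans (expR_ge1Dx 1); lra.
  rewrite -expRM_natl mulr1 ler_expR natrM ler_wpM2l//.
  by apply: le_trans rA _; rewrite ler_wpM2r// ler_norm.
have one : 1 <= n%:R `^ (72 * `|A|) :> R.
  by rewrite -[leLHS](powRr0 n%:R); apply: ler_powR => //; rewrite mulr_ge0.
have p0 : 0 < n%:R `^ (72 * `|A|) :> R by exact: lt_le_trans one.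
rewrite powRN powRD; last by rewrite gt_eqF ?implybT.
rewrite powRr1 ?ler0n// invfM mulrA ler_wpM2r ?invr_ge0 ?ler0n//.
by rewrite ler_pdivrMr//; lra.
Qed.

Theorem corollary7p6 (R : realType) (F : scalar_field) (c : R) (m r : nat -> nat)
    (d : nat -> measure_display) (T : forall n, measurableType (d n))
    (P : forall n, probability (T n) R)
    (mu : probability (measurableTypeR R) R)
    (X : forall n, T n -> 'M[R[i]]_(n, m n))
    (U : forall n, T n -> 'M[R[i]]_(n, r n))
    (V : forall n, T n -> 'M[R[i]]_(m n, r n)) (A : R) :
  0 < c <= 1 ->
  (forall n, (n <= m n)%N) ->
  (fun n => n%:R / (m n)%:R : R) @ \oo --> c ->
  (forall n, mx_measurable (X n)) ->
  (forall n w, X n w \is a mxOver (scalars F)) ->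
  global_noise_law P X mu ->
  (forall n, mx_measurable (U n) /\ mx_measurable (V n)) ->
  (forall n w, stiefel F (U n w) /\ stiefel F (V n w)) ->
  isotropic_local_law F P X mu c ->
  (forall n, deterministic (fun w => (U n w, V n w)) \/
     indep_generated (P n) (mx_events (X n))
       (mx_events (U n) `|` mx_events (V n))) ->
  (\forall n \near \oo, (r n)%:R <= A * ln (n%:R : R)) ->
  holomorphic_subspace_local_law P X U V mu c.
Proof.
move=> _ _ _ mX _ _ mUV UV iso ind rA K cK Kcut.
(* The exponent [72 |A| + 1] leaves a factor [2 / n] after the union bound. *)
have D0 : 0 < 72 * `|A| + 1 by rewrite ltr_wpDl// mulr_ge0.
have [a [a0 acvg] [N _ law]] := iso K (72 * `|A| + 1) cK Kcut D0.
exists (fun n => 8 * a n).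
  split; first by move=> n; rewrite mulr_ge0.
  by rewrite -(mulr0 8); apply: cvgM => //; exact: cvg_cst.
have lower : ((1 - 2 * n%:R^-1)%:E : \bar R) @[n --> \oo] --> (1%:E : \bar R).
  apply: cvg_EFin; first by near=> n.
  rewrite -[X in _ --> X]subr0; apply: cvgB; first exact: cvg_cst.
  rewrite -[X in _ --> X](mulr0 2); apply: cvgM; first exact: cvg_cst.
  by rewrite -(cvg_shiftS (fun n => n%:R^-1 : R)); exact: cvg_harmonic.
apply: (squeeze_cvge _ lower (cvg_cst _)).
near=> n.
have n0 : (0 < n)%N by near: n; exact: nbhs_infty_gt.
have [mUn mVn] := mUV n.
have nm0 : (0 < n + m n)%N by rewrite addn_gt0 n0.
have eta0 : 0 <= n%:R `^ (- (72 * `|A| + 1)) :> R by exact: powR_ge0.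
have lawn (p q : 'cV[R[i]]_(n + m n)) : unit_vectors F p -> unit_vectors F q ->
    (P n [set w | (a n)%:E < resolvent_sup (hermitization (X n w)) K
      (bilinear_error mu c p q)] <= (n%:R `^ (- (72 * `|A| + 1)))%:E)%E.
  move=> pF qF.
  apply: le_trans (law n _); last by near: n; exact: nbhs_infty_ge.
  by apply: ereal_sup_ubound; exists p => //; exists q.
have [mgood tail] :=
  opnorm_tail nm0 (mX n) mUn mVn (UV n) (ind n) cK (a0 n) eta0 lawn.
apply/andP; split; last exact: probability_le1.
rewrite -[X in P n X]setCK probability_setC; last exact: measurableC.
rewrite EFinB; apply: leeB => //; apply: le_trans tail _.
rewrite lee_fin; apply: net_cardinality_beaten => //.
by near: n.
Unshelve. all: by end_near.
Qed.
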